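(* Let $(\mathcal A,\cdot,\|\cdot\|)$ be a Banach algebra that is Arens irregular. Then there exists $\epsilon_0>0$ (depending on $(\mathcal A,\cdot,\|\cdot\|)$) such that for every $0<\epsilon<\epsilon_0$, every $\epsilon$-perturbation $(\mathcal A,\times)$ of $(\mathcal A,\cdot,\|\cdot\|)$ is Arens irregular.
   Context: $\epsilon$-perturbation: given a Banach algebra $(\mathcal A,\cdot,\|\cdot\|)$, an (algebraic) $\epsilon$-perturbation is an (associative) algebra $(\mathcal A,\times)$ on the same underlying vector space, with the same linear structure, such that $\|a\times b-a\cdot b\|\le \epsilon\|a\|\,\|b\|$ for all $a,b\in\mathcal A$. The product $\times$ is then a bounded bilinear map for $\|\cdot\|$, and there is a norm $\|\cdot\|_1$ on $\mathcal A$, equivalent to $\|\cdot\|$, such that $(\mathcal A,\times,\|\cdot\|_1)$ is a Banach algebra. The dual $\mathcal A^*$ and bidual $\mathcal A^{**}$ are the same vector spaces for both norms. Arens (ir)regularity of $(\mathcal A,\times)$ means that of $(\mathcal A,\times,\|\cdot\|_1)$; the Arens products depend only on the bounded bilinear map $\times$, not on the choice of equivalent norm. Arens products: for a Banach algebra $\mathcal A$ with product written $ab$, and $a\in\mathcal A$, $\omega\in\mathcal A^*$, $f,g\in\mathcal A^{**}$, define $\omega_a,{}_a\omega\in\mathcal A^*$ by $\omega_a(b)=\omega(ab)$ and ${}_a\omega(b)=\omega(ba)$ for $b\in\mathcal A$, and define $\omega_f,{}_f\omega\in\mathcal A^*$ by $\omega_f(a)=f({}_a\omega)$ and ${}_f\omega(a)=f(\omega_a)$.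 The first and second Arens products on $\mathcal A^{**}$ are $(f\,\square\, g)(\omega)=f({}_g\omega)$ and $(f\diamond g)(\omega)=g(\omega_f)$. The algebra $\mathcal A$ is Arens regular if $f\,\square\, g=f\diamond g$ for all $f,g\in\mathcal A^{**}$, and Arens irregular otherwise. *)

(* Defs.v *)
From HB Require Import structures.
From mathcomp Require Import all_boot all_order all_algebra.
From mathcomp Require Import complex.
From mathcomp Require Import boolp classical_sets functions reals topology.
From mathcomp Require Import normedtype.

Set Implicit Arguments.
Unset Strict Implicit.
Unset Printing Implicit Defensive.

Import Order.TTheory GRing.Theory Num.Theory.
Import numFieldNormedType.Exports.

Local Open Scope classical_set_scope.
Local Open Scope ring_scope.
Local Open Scope complex_scope.

Variant scalar_kind := RealScalars | ComplexScalars.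

Definition scalar_field (R : realType) (k : scalar_kind) : numFieldType :=
  match k with RealScalars => R | ComplexScalars => R[i] end.

Section ScalarReal.
Variables (R : realType) (k : scalar_kind).

(* Norms of a normed module over R[i] take values in the nonnegative reals of
   R[i]; the two maps below pass between these and R, where suprema exist. *)
Definition scalar_re : scalar_field R k -> R :=
  match k return scalar_field R k -> R with
  | RealScalars => id
  | ComplexScalars => fun z => complex.Re z
  end.

Definition scalar_of : R -> scalar_field R k :=
  match k return R -> scalar_field R k with
  | RealScalars => id
  | ComplexScalars => fun x => x%:C
  end.

Lemma scalar_ofK : cancel scalar_of scalar_re.
Proof. by rewrite /scalar_of /scalar_re; case: k. Qed.

Lemma scalar_reK (z : scalar_field R k) : 0 <= z -> scalar_of (scalar_re z) = z.
Proof.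
rewrite /scalar_of /scalar_re; case: k z => [//|/= -[x y]].
by rewrite lecE /= => /andP[/eqP -> _].
Qed.

Lemma scalar_of_ler (x y : R) : (scalar_of x <= scalar_of y) = (x <= y).
Proof. by rewrite /scalar_of; case: k => //=; rewrite lecR. Qed.

Lemma scalar_of0 : scalar_of 0 = 0.
Proof. by rewrite /scalar_of; case: k. Qed.

End ScalarReal.

Section DualSpace.
Variables (K : numFieldType) (V : normedModType K).

Definition dual_pred : {pred V -> K^o} :=
  mem [set w : V -> K^o | linear w /\ continuous w].

Record dual := Dual { dual_fun :> V -> K^o; _ : dual_fun \in dual_pred }.

HB.instance Definition _ := [isSub for dual_fun].
HB.instance Definition _ := [Choice of dual by <:].

Lemma dual_linear (w : dual) : linear w.
Proof. by case: w => w /=; rewrite inE => -[]. Qed.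

Lemma dual_continuous (w : dual) : continuous w.
Proof. by case: w => w /=; rewrite inE => -[]. Qed.

Let dual_lin (w : dual) := GRing.isLinear.Build _ _ _ _ _ (dual_linear w).
HB.instance Definition _ (w : dual) := dual_lin w.

Lemma dual_bounded (w : dual) : exists C, forall a, `|w a| <= C * `|a|.
Proof.
have /linear_boundedP := (proj2 (@linear_bounded_continuous _ _ _ w))
  (@dual_continuous w).
by move=> /pinfty_ex_gt0[C _ hC]; exists C.
Qed.

Lemma dual_predP (w : V -> K^o) : linear w ->
  (exists C, forall a, `|w a| <= C * `|a|) -> w \in dual_pred.
Proof.
move=> lw [C hC]; rewrite inE; split => //.
pose L := GRing.isLinear.Build _ _ _ _ _ lw.
pose f : {linear V -> K^o} := HB.pack w L.
apply: (@bounded_linear_continuous _ _ _ f).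
apply/ex_bound; exists `|C|.
apply/nbhs_norm0P; exists 1 => //= x /= x1; apply: (le_trans (hC x)).
have [C0|C0] := boolP (0 <= C).
  by rewrite (ger0_norm C0) ler_piMr // ltW.
have : C * `|x| \is Num.real by rewrite ger0_real// (le_trans _ (hC x)).
have [->|x0] := eqVneq x 0; first by rewrite normr0 mulr0.
by move=> _; have := le_trans (normr_ge0 _) (hC x);
  rewrite pmulr_lge0 ?normr_gt0// (negbTE C0).
Qed.

Lemma dual_submod_closed : submod_closed dual_pred.
Proof.
split.
  apply: dual_predP; first by move=> a u v /=; rewrite scaler0 addr0.
  by exists 0 => a; rewrite normr0 mul0r.
move=> a u v; rewrite !inE => -[lu cu] [lv cv]; split.
  move=> b x y; rewrite /= !fctE lu lv.
  rewrite !scalerDr !scalerA (mulrC a b) -!addrA; congr (_ + _).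
  by rewrite addrCA.
move=> x; apply: cvgD; last exact: cv.
by apply: cvgZr; exact: cu.
Qed.

HB.instance Definition _ := GRing.isSubmodClosed.Build _ _ dual_pred
  dual_submod_closed.
HB.instance Definition _ := [SubChoice_isSubLmodule of dual by <:].

End DualSpace.

Section OperatorNorm.
Variables (R : realType) (k : scalar_kind).
Local Notation K := (scalar_field R k).
Variable V : normedModType K.

(* sup of |w a| over the closed unit ball, as an element of K *)
Definition opnorm (w : dual V) : K :=
  scalar_of k (sup [set scalar_re `|w a| | a in [set a | `|a| <= 1]]).

Let unit_values (w : dual V) :=
  [set scalar_re `|w a| | a in [set a : V | `|a| <= 1]].

Let unit_values_ub (w : dual V) (M : K) : 0 <= M ->
  (forall a, `|w a| <= M * `|a|) -> ubound (unit_values w) (scalar_re M).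
Proof.
move=> M0 hM _ [a a1 <-]; rewrite -(scalar_of_ler k) !scalar_reK//.
by rewrite (le_trans (hM a))// ler_piMr.
Qed.

Lemma dual_bounded_ge0 (w : dual V) :
  exists2 C : K, 0 <= C & forall a, `|w a| <= C * `|a|.
Proof.
have [C hC] := dual_bounded w.
have [C0|/negP C0] := boolP (0 <= C); first by exists C.
exists 0 => // a; rewrite mul0r.
have [->|a0] := eqVneq a 0; first by rewrite linear0 normr0.
exfalso; apply: C0; have := le_trans (normr_ge0 _) (hC a).
by rewrite pmulr_lge0 ?normr_gt0.
Qed.

Let unit_values_has_sup (w : dual V) : has_sup (unit_values w).
Proof.
split; first by exists (scalar_re `|w 0|), 0 => //=; rewrite normr0 ler01.
have [C C0 hC] := dual_bounded_ge0 w.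
by exists (scalar_re C); exact: unit_values_ub.
Qed.

Lemma opnorm_ge0 (w : dual V) : 0 <= opnorm w.
Proof.
rewrite /opnorm -(scalar_of0 R k) scalar_of_ler.
apply: (@ub_le_sup _ (unit_values w)); first by case: (unit_values_has_sup w).
exists 0; first by rewrite /= normr0 ler01.
by rewrite linear0 normr0 -(scalar_of0 R k) scalar_ofK.
Qed.

Lemma opnorm_le (w : dual V) (M : K) : 0 <= M ->
  (forall a, `|w a| <= M * `|a|) -> opnorm w <= M.
Proof.
move=> M0 hM; rewrite /opnorm -(scalar_reK M0) scalar_of_ler.
apply: ge_sup; last exact: unit_values_ub.
by case: (unit_values_has_sup w).
Qed.

Lemma le_opnorm (w : dual V) (a : V) : `|w a| <= opnorm w * `|a|.
Proof.
have [->|a0] := eqVneq a 0; first by rewrite linear0 !normr0 mulr0.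
have na0 : 0 < `|a| by rewrite normr_gt0.
have -> : `|w a| = `|w (`|a|^-1 *: a)| * `|a|.
  rewrite linearZ normrZ normfV normr_id mulrAC mulVf ?mul1r//.
  by rewrite gt_eqF.
rewrite ler_pM2r// /opnorm -[leLHS](scalar_reK (normr_ge0 _)) scalar_of_ler.
apply: (@ub_le_sup _ (unit_values w)); first by case: (unit_values_has_sup w).
exists (`|a|^-1 *: a) => //=.
by rewrite normrZ normfV normr_id mulVf ?gt_eqF.
Qed.

Lemma opnormD (v w : dual V) : opnorm (v + w) <= opnorm v + opnorm w.
Proof.
apply: opnorm_le => [|a]; first by rewrite addr_ge0 ?opnorm_ge0.
rewrite mulrDl; apply: (le_trans (ler_normD _ _)).
by apply: lerD; exact: le_opnorm.
Qed.

Lemma opnorm0_eq0 (w : dual V) : opnorm w = 0 -> w = 0.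
Proof.
move=> w0; apply/val_inj/funext => a /=; apply/eqP; rewrite -normr_le0.
by rewrite (le_trans (le_opnorm w a))// w0 mul0r.
Qed.

Lemma opnormZ (c : K) (w : dual V) : opnorm (c *: w) = `|c| * opnorm w.
Proof.
have le (d : K) (u : dual V) : opnorm (d *: u) <= `|d| * opnorm u.
  apply: opnorm_le => [|a]; first by rewrite mulr_ge0 ?opnorm_ge0.
  by rewrite [(d *: u) a]/(d *: (u a)) normrZ -mulrA ler_wpM2l// le_opnorm.
apply/le_anti/andP; split; first exact: le.
have [->|c0] := eqVneq c 0; first by rewrite normr0 mul0r opnorm_ge0.
have {1}-> : w = c^-1 *: (c *: w) by rewrite scalerA mulVf// scale1r.
by rewrite -ler_pdivlMl ?normr_gt0// -normfV.
Qed.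

HB.instance Definition _ :=
  Lmodule_isNormed.Build K (dual V) opnormD opnormZ opnorm0_eq0.

Lemma dual_norm_le (w : dual V) (M : K) : 0 <= M ->
  (forall a, `|w a| <= M * `|a|) -> `|w| <= M.
Proof. exact: opnorm_le. Qed.

Lemma dual_norm_ge (w : dual V) (a : V) : `|w a| <= `|w| * `|a|.
Proof. exact: le_opnorm. Qed.

End OperatorNorm.

Record algebra_product (K : numFieldType) (A : lmodType K) (m : A -> A -> A) :
  Prop := AlgebraProduct {
  algprodA : associative m;
  algprod_linearr : forall a, linear (m a);
  algprod_linearl : forall b, linear (fun a => m a b)
}.

Record banach_algebra (K : numFieldType) (A : completeNormedModType K)
  (m : A -> A -> A) : Prop := BanachAlgebra {
  banach_algebra_product : algebra_product m;
  banach_algebra_normM : forall a b, `|m a b| <= `|a| * `|b|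
}.

Record perturbation (K : numFieldType) (A : completeNormedModType K)
  (m : A -> A -> A) (eps : K) (p : A -> A -> A) : Prop := Perturbation {
  perturbation_algebra_product : algebra_product p;
  perturbation_norm : forall a b, `|p a b - m a b| <= eps * `|a| * `|b|
}.

(* The Arens products of an algebra depend on the norm only through the bounded
   linear functionals, so they are defined for any bounded associative bilinear
   product; no submultiplicative renorming has to be chosen. *)
Record bounded_product (K : numFieldType) (A : normedModType K) :=
  BoundedProduct {
  bprod :> A -> A -> A;
  bprod_algebra_product : algebra_product bprod;
  bprod_bounded : exists2 C, 0 <= C &
    forall a b, `|bprod a b| <= C * (`|a| * `|b|)
}.

Section ToBoundedProduct.
Variables (K : numFieldType) (A : completeNormedModType K).
Variable m : A -> A -> A.
Hypothesis Hm : banach_algebra m.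

Lemma banach_bounded :
  exists2 C, 0 <= C & forall a b, `|m a b| <= C * (`|a| * `|b|).
Proof. by exists 1 => // a b; rewrite mul1r; exact: banach_algebra_normM. Qed.

Definition banach_product : bounded_product A :=
  BoundedProduct (banach_algebra_product Hm) banach_bounded.

Variables (eps : K) (p : A -> A -> A).
Hypothesis eps0 : 0 < eps.
Hypothesis Hp : perturbation m eps p.

Lemma perturbation_bounded :
  exists2 C, 0 <= C & forall a b, `|p a b| <= C * (`|a| * `|b|).
Proof.
exists (eps + 1) => [|a b]; first by rewrite addr_ge0// ltW.
rewrite -(subrK (m a b) (p a b)) mulrDl mul1r mulrA.
apply: (le_trans (ler_normD _ _)); apply: lerD.
  exact: perturbation_norm Hp a b.
exact: banach_algebra_normM.
Qed.

Definition perturbed_product : bounded_product A :=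
  BoundedProduct (perturbation_algebra_product Hp) perturbation_bounded.

End ToBoundedProduct.

Section Arens.
Variables (R : realType) (k : scalar_kind).
Local Notation K := (scalar_field R k).
Variable A : normedModType K.
Variable m : bounded_product A.
Implicit Types (a b : A) (w : dual A) (f g : dual (dual A)).

Lemma funr_subproof w a : (fun b => w (m a b)) \in @dual_pred K A.
Proof.
apply: dual_predP => [c x y|].
  by rewrite (algprod_linearr (bprod_algebra_product m)) dual_linear.
have [C C0 hC] := bprod_bounded m; exists (`|w| * (C * `|a|)) => b.
by rewrite (le_trans (dual_norm_ge w _))// -!mulrA ler_wpM2l// hC.
Qed.

Lemma funl_subproof a w : (fun b => w (m b a)) \in @dual_pred K A.
Proof.
apply: dual_predP => [c x y|].
  by rewrite (algprod_linearl (bprod_algebra_product m)) dual_linear.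
have [C C0 hC] := bprod_bounded m; exists (`|w| * (C * `|a|)) => b.
rewrite (le_trans (dual_norm_ge w _))// -!mulrA ler_wpM2l//.
by rewrite [`|a| * _]mulrC hC.
Qed.

(* [funr w a] is w_a : b |-> w (a b) and [funl a w] is _a w : b |-> w (b a). *)
Definition funr w a : dual A := Dual (funr_subproof w a).
Definition funl a w : dual A := Dual (funl_subproof a w).

Lemma funr_linearl a : linear (fun w => funr w a).
Proof. by move=> c v w; apply/val_inj/funext. Qed.

Lemma funl_linearr a : linear (funl a).
Proof. by move=> c v w; apply/val_inj/funext. Qed.

Lemma funr_linearr w : linear (funr w).
Proof.
move=> c x y; apply/val_inj/funext => b /=.
by rewrite (algprod_linearl (bprod_algebra_product m)) dual_linear.
Qed.

Lemma funl_linearl w : linear (fun a => funl a w).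
Proof.
move=> c x y; apply/val_inj/funext => b /=.
by rewrite (algprod_linearr (bprod_algebra_product m)) dual_linear.
Qed.

Lemma funr_funl_bounded : exists2 C : K, 0 <= C &
  forall w a, `|funr w a| <= C * (`|w| * `|a|) /\
              `|funl a w| <= C * (`|w| * `|a|).
Proof.
have [C C0 hC] := bprod_bounded m; exists C => // w a; split.
  apply: dual_norm_le => [|b]; first by rewrite !mulr_ge0.
  rewrite (le_trans (dual_norm_ge w _))// mulrCA -!mulrA ler_wpM2l// hC.
apply: dual_norm_le => [|b]; first by rewrite !mulr_ge0.
rewrite (le_trans (dual_norm_ge w _))// mulrCA -!mulrA ler_wpM2l//.
by rewrite [`|a| * _]mulrC hC.
Qed.

Lemma bifunr_subproof w f : (fun a => f (funl a w)) \in @dual_pred K A.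
Proof.
apply: dual_predP => [c x y|]; first by rewrite funl_linearl dual_linear.
have [C C0 hC] := funr_funl_bounded; exists (`|f| * (C * `|w|)) => a.
rewrite (le_trans (dual_norm_ge f _))// -!mulrA ler_wpM2l//.
by have [] := hC w a.
Qed.

Lemma bifunl_subproof f w : (fun a => f (funr w a)) \in @dual_pred K A.
Proof.
apply: dual_predP => [c x y|]; first by rewrite funr_linearr dual_linear.
have [C C0 hC] := funr_funl_bounded; exists (`|f| * (C * `|w|)) => a.
rewrite (le_trans (dual_norm_ge f _))// -!mulrA ler_wpM2l//.
by have [] := hC w a.
Qed.

(* [bifunr w f] is w_f : a |-> f (_a w) and [bifunl f w] is
   _f w : a |-> f (w_a); the sides are swapped. *)
Definition bifunr w f : dual A := Dual (bifunr_subproof w f).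
Definition bifunl f w : dual A := Dual (bifunl_subproof f w).

Lemma bifunr_linearl f : linear (fun w => bifunr w f).
Proof.
move=> c v w; apply/val_inj/funext => a /=.
by rewrite funl_linearr dual_linear.
Qed.

Lemma bifunl_linearr f : linear (bifunl f).
Proof.
move=> c v w; apply/val_inj/funext => a /=.
by rewrite funr_linearl dual_linear.
Qed.

Lemma bifunr_bifunl_bounded : exists2 C : K, 0 <= C &
  forall w f, `|bifunr w f| <= C * (`|f| * `|w|) /\
              `|bifunl f w| <= C * (`|f| * `|w|).
Proof.
have [C C0 hC] := funr_funl_bounded; exists C => // w f.
split; (apply: dual_norm_le => [|a]; first by rewrite !mulr_ge0);
  rewrite (le_trans (dual_norm_ge f _))// mulrCA -!mulrA ler_wpM2l//;
  by have [] := hC w a.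
Qed.

Lemma arens1_subproof f g : (fun w => f (bifunl g w)) \in @dual_pred K (dual A).
Proof.
apply: dual_predP => [c v w|]; first by rewrite bifunl_linearr dual_linear.
have [C C0 hC] := bifunr_bifunl_bounded; exists (`|f| * (C * `|g|)) => w.
rewrite (le_trans (dual_norm_ge f _))// -!mulrA ler_wpM2l//.
by have [] := hC w g.
Qed.

Lemma arens2_subproof f g : (fun w => g (bifunr w f)) \in @dual_pred K (dual A).
Proof.
apply: dual_predP => [c v w|]; first by rewrite bifunr_linearl dual_linear.
have [C C0 hC] := bifunr_bifunl_bounded; exists (`|g| * (C * `|f|)) => w.
rewrite (le_trans (dual_norm_ge g _))// -!mulrA ler_wpM2l//.
by have [] := hC w f.
Qed.

Definition arens1 f g : dual (dual A) := Dual (arens1_subproof f g).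
Definition arens2 f g : dual (dual A) := Dual (arens2_subproof f g).

Definition arens_regular : Prop := forall f g, arens1 f g = arens2 f g.
Definition arens_irregular : Prop := ~ arens_regular.

End Arens.

(* Main.v *)
(** Both Arens products depend Lipschitz-continuously on the underlying product:
    replacing [m] by an [eps]-perturbation moves [(f □ g)(w)] and [(f ◇ g)(w)]
    by at most [eps |f| |g| |w|].  If the two products differ by [d > 0] at some
    [f], [g], [w], they still differ after any perturbation with
    [2 eps |f| |g| |w| < d]. *)
Require Import Defs.
From mathcomp Require Import all_boot all_order all_algebra.
From mathcomp Require Import boolp reals normedtype.

Set Implicit Arguments.
Unset Strict Implicit.
Unset Printing Implicit Defensive.

Import Order.TTheory GRing.Theory Num.Theory.

Local Open Scope ring_scope.

Section ArensPerturbation.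
Variables (R : realType) (k : scalar_kind).
Local Notation K := (scalar_field R k).

(** Stated for general [V] because the nested Arens formulas need it both on [A] (for [w]) and on
    [dual A] (for [f], [g]). *)
Lemma dual_dist_le (V : normedModType K) (w : dual V) (a b : V) (e : K) :
  `|a - b| <= e -> `|w a - w b| <= e * `|w|.
Proof.
move=> abe; rewrite -linearB (le_trans (dual_norm_ge w _))//.
by rewrite mulrC ler_wpM2r.
Qed.

Lemma dual_norm_sub_le (V : normedModType K) (v w : dual V) (e : K) : 0 <= e ->
  (forall a, `|v a - w a| <= e * `|a|) -> `|v - w| <= e.
Proof. by move=> e0 vwe; apply: dual_norm_le. Qed.

Variables (A : normedModType K) (m p : bounded_product A) (eps : K).
Hypothesis eps_ge0 : 0 <= eps.
Hypothesis pm_le : forall a b, `|p a b - m a b| <= eps * `|a| * `|b|.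
Implicit Types (w : dual A) (f g : dual (dual A)).

(** Peel off [f], then [g], then [w]: each is Lipschitz with its norm as constant, and what remains
    is [p a b - m a b]. *)
Lemma arens1_dist_le f g w :
  `|arens1 p f g w - arens1 m f g w| <= eps * `|w| * `|g| * `|f|.
Proof.
apply: (dual_dist_le f (a := bifunl p g w) (b := bifunl m g w)).
apply: dual_norm_sub_le => [|a]; first by rewrite !mulr_ge0.
rewrite mulrAC; apply: (dual_dist_le g (a := funr p w a) (b := funr m w a)).
apply: dual_norm_sub_le => [|b]; first by rewrite !mulr_ge0.
rewrite (mulrAC eps) (mulrAC _ `|w|).
exact: (dual_dist_le w (a := p a b) (b := m a b)).
Qed.

(** The same peeling, but here [g] is outermost and [f] comes next. *)
Lemma arens2_dist_le f g w :
  `|arens2 p f g w - arens2 m f g w| <= eps * `|w| * `|f| * `|g|.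
Proof.
apply: (dual_dist_le g (a := bifunr p w f) (b := bifunr m w f)).
apply: dual_norm_sub_le => [|a]; first by rewrite !mulr_ge0.
rewrite mulrAC; apply: (dual_dist_le f (a := funl p a w) (b := funl m a w)).
apply: dual_norm_sub_le => [|b]; first by rewrite !mulr_ge0.
(* [funl] multiplies by [a] on the right, so [pm_le] is used at [b], [a]. *)
rewrite (mulrAC _ `|a|) (mulrAC eps) (mulrAC _ `|w|).
exact: (dual_dist_le w (a := p b a) (b := m b a)).
Qed.

(** Triangle inequality through the value that both Arens products of [p] share. *)
Lemma arens_regular_dist_le f g w : arens_regular p ->
  `|arens1 m f g w - arens2 m f g w| <= eps * (2 * (`|f| * `|g| * `|w|)).
Proof.
move=> p_reg.
have -> : eps * (2 * (`|f| * `|g| * `|w|)) =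
    eps * `|w| * `|g| * `|f| + eps * `|w| * `|f| * `|g|.
  by rewrite mulrCA mulr_natl mulr2n; congr (_ + _);
    rewrite -!mulrA; congr (_ * _); rewrite !mulrA mulrC mulrA // mulrAC.
apply: le_trans (ler_distD (arens1 p f g w) _ _) _; apply: lerD.
  by rewrite distrC arens1_dist_le.
by rewrite p_reg arens2_dist_le.
Qed.

End ArensPerturbation.

Theorem corollary1 (R : realType) (k : scalar_kind)
    (A : completeNormedModType (scalar_field R k)) (mul : A -> A -> A)
    (mulP : banach_algebra mul) :
  arens_irregular (banach_product mulP) ->
  exists2 eps0 : scalar_field R k, 0 < eps0 &
    forall eps : scalar_field R k, forall eps_gt0 : 0 < eps, eps < eps0 ->
    forall (times : A -> A -> A) (timesP : perturbation mul eps times),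
      arens_irregular (perturbed_product mulP eps_gt0 timesP).
Proof.
move=> /existsNP[f /existsNP[g fg_neq]].
have [w fgw_neq] : exists w,
    arens1 (banach_product mulP) f g w != arens2 (banach_product mulP) f g w.
  apply: contra_notP fg_neq => /forallNP fgw_eq.
  by apply/val_inj/funext => w; apply/eqP/negPn/negP/fgw_eq.
set d := `|arens1 (banach_product mulP) f g w
           - arens2 (banach_product mulP) f g w|.
have d_gt0 : 0 < d by rewrite normr_gt0 subr_eq0.
set c := 2 * (`|f| * `|g| * `|w|).
have c1_gt0 : 0 < c + 1 by rewrite ltr_wpDl// !mulr_ge0.
(* The [+ 1] gives a positive denominator without proving [c] nonzero, and makes
   [eps * c < eps * (c + 1) < d] strict. *)
exists (d / (c + 1)); first by rewrite divr_gt0.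
move=> eps eps_gt0; rewrite ltr_pdivlMr// => eps_lt times timesP times_reg.
have d_le : d <= eps * c.
  apply: (arens_regular_dist_le (m := banach_product mulP)
    (p := perturbed_product mulP eps_gt0 timesP) (ltW eps_gt0)) times_reg.
  exact: perturbation_norm timesP.
suff : d < d by rewrite ltxx.
by rewrite (le_lt_trans d_le)// (lt_trans _ eps_lt)// ltr_pM2l// ltrDl ltr01.
Qed.
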